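(* Let $\Delta>0$ and let $\mathtt q$ be the uniform quantizer of step $\Delta$. There are weakly connected and weight-balanced weighted directed graphs $G$ (with $N$ nodes and Laplacian matrix $L$) and initial conditions in $\mathbb{R}^N$ for which no Carathéodory solution to $\dot x=-L\,\mathtt q(x)$ exists. Moreover, in these cases, there is a positive-measure set of initial conditions in $\mathbb{R}^N$ such that Carathéodory solutions to $\dot x=-L\,\mathtt q(x)$ starting from that set are not complete.
   Context: A weighted directed graph $G=(V,E,A)$ has node set $V=\{1,\dots,N\}$, edge set $E\subset V\times V$ without self-loops, and adjacency matrix $A\in\mathbb{R}_{\ge0}^{N\times N}$ with $A_{ij}>0$ if $(j,i)\in E$ and $A_{ij}=0$ if $(j,i)\notin E$. It is weight-balanced if $\sum_j A_{ij}=\sum_j A_{ji}$ for every $i\in V$ (in-degree equals out-degree at each node); it is weakly connected if any two nodes are joined by a path of edges, disregarding orientation. The Laplacian is $L=\mathrm{diag}(A\mathbf 1)-A$, with $\mathbf 1$ the all-ones vector in $\mathbb{R}^N$. Uniform quantizer: $\mathtt q(r)=\left\lfloor \frac{r}{\Delta}+\frac12\right\rfloor\Delta$ for $r\in\mathbb{R}$, applied componentwise to vectors. An absolutely continuous function $x(t)$ is a Carathéodory solution to $\dot x=-L\,\mathtt q(x)$ on an interval $I$ if $\dot x(t)=-L\,\mathtt q(x(t))$ for almost every $t\in I$. Such a solution is said to be complete if $I=[0,+\infty)$. The initial condition of a solution is its value $x(0)$. *)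

(* Defs.v *)
From HB Require Import structures.
From mathcomp Require Import all_boot all_order all_algebra.
From mathcomp Require Import all_classical all_reals all_analysis.
Import Order.TTheory GRing.Theory Num.Theory.
Import numFieldNormedType.Exports.

Set Implicit Arguments.
Unset Strict Implicit.
Unset Printing Implicit Defensive.

Local Open Scope classical_set_scope.
Local Open Scope ring_scope.

(* Orientation convention: [adj i j] is the weight of the edge [(j, i)]. *)
Record wdigraph (R : realType) (N : nat) := WDigraph {
  edges : {set 'I_N * 'I_N} ;
  adj : 'M[R]_N ;
  edges_irrefl : forall i, (i, i) \notin edges ;
  adj_gt0 : forall i j, (j, i) \in edges -> 0 < adj i j ;
  adj_eq0 : forall i j, (j, i) \notin edges -> adj i j = 0 }.

Definition weight_balanced (R : realType) (N : nat) (G : wdigraph R N) :=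
  forall i, \sum_j adj G i j = \sum_j adj G j i.

Definition weakly_connected (R : realType) (N : nat) (G : wdigraph R N) :=
  forall i j,
    connect (fun u v => ((u, v) \in edges G) || ((v, u) \in edges G)) i j.

Definition laplacian (R : realType) (N : nat) (G : wdigraph R N) : 'M[R]_N :=
  diag_mx (adj G *m const_mx 1 : 'cV[R]_N)^T - adj G.

Definition quantizer (R : realType) (Delta r : R) : R :=
  (Num.floor (r / Delta + 1 / 2%:R))%:~R * Delta.

Definition absolutely_continuous_on (R : realType) (V : normedModType R)
    (a b : R) (f : R -> V) :=
  forall e : R, 0 < e -> exists2 d : R, 0 < d &
    forall (n : nat) (u v : 'I_n -> R),
      (forall i, [/\ a <= u i, u i <= v i & v i <= b]) ->
      (forall i j, i != j -> v i <= u j \/ v j <= u i) ->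
      \sum_i (v i - u i) < d ->
      \sum_i `|f (v i) - f (u i)| < e.

(* On an interval that is not compact, absolute continuity is understood
   on every compact subinterval.  [x] is a total function of which only the
   restriction to [I] matters: the two-sided derivative differs from the
   derivative relative to [I] at most at the endpoints of [I]. *)
Definition caratheodory_solution (R : realType) (N : nat) (Delta : R)
    (G : wdigraph R N) (I : set R) (x : R -> 'cV[R]_N) :=
  [/\ is_interval I,
      forall a b : R, a <= b -> `[a, b] `<=` I ->
        absolutely_continuous_on a b x
    & {ae @lebesgue_measure R, forall t, I t ->
        is_derive (t : R) 1 x
          (- (laplacian G *m map_mx (quantizer Delta) (x t)))}].

(* Solutions run forward in time from 0; a singleton [I = {0}] is excluded,
   since the differential equation would be vacuous on it. *)
Definition caratheodory_solution_from (R : realType) (N : nat) (Delta : R)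
    (G : wdigraph R N) (x0 : 'cV[R]_N) (I : set R) (x : R -> 'cV[R]_N) :=
  [/\ I `<=` `[0, +oo[, I 0, exists2 t : R, 0 < t & I t,
      caratheodory_solution Delta G I x & x 0 = x0].

Definition no_caratheodory_solution (R : realType) (N : nat) (Delta : R)
    (G : wdigraph R N) (x0 : 'cV[R]_N) :=
  ~ exists (I : set R) (x : R -> 'cV[R]_N),
      caratheodory_solution_from Delta G x0 I x.

Definition complete_domain (R : realType) (I : set R) :=
  I = [set` `[0, +oo[].

(* N-dimensional Lebesgue measure on the Borel sets of [N.-tuple R], by
   iterated products of the one-dimensional one. *)
Fixpoint lebesgue_tuple (R : realType) (n : nat) :
    set (n.-tuple (measurableTypeR R)) -> \bar R :=
  match n with
  | 0 => @dirac _ (0.-tuple (measurableTypeR R)) [tuple] R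
  | m.+1 => pushforward (lebesgue_measure \x @lebesgue_tuple R m)%E
      (fun p => [tuple of p.1 :: p.2] : m.+1.-tuple (measurableTypeR R))
  end.

Section lebesgue_tuple_theory.
Variable R : realType.
Local Notation T n := (n.-tuple (measurableTypeR R)).

Lemma measurable_cons_pair m :
  measurable_fun [set: (measurableTypeR R * T m)%type]
    (fun p => [tuple of p.1 :: p.2] : T m.+1).
Proof. exact: (measurable_cons measurable_fst measurable_snd). Qed.


Section step.
Variables (m : nat) (mu : {sigma_finite_measure set (T m) -> \bar R}).
Definition lebesgue_cons : set (T m.+1) -> \bar R :=
  pushforward (lebesgue_measure \x mu)%E
    (fun p => [tuple of p.1 :: p.2] : T m.+1).

Let lebesgue_cons0 : lebesgue_cons set0 = 0%E.
Proof. by rewrite /lebesgue_cons /pushforward preimage_set0 measure0. Qed.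

Let lebesgue_cons_ge0 A : (0 <= lebesgue_cons A)%E.
Proof. exact: (measure_ge0 (lebesgue_measure \x mu)%E). Qed.

Let lebesgue_cons_sigma_additive : semi_sigma_additive lebesgue_cons.
Proof.
move=> F mF tF mUF; rewrite /lebesgue_cons /pushforward preimage_bigcup.
apply: measure_semi_sigma_additive.
- by move=> n; rewrite -[X in measurable X]setTI; exact: measurable_cons_pair.
- apply/trivIsetP => /= i j _ _ ij; rewrite -preimage_setI.
  by move/trivIsetP : tF => /(_ _ _ _ _ ij) ->//; rewrite preimage_set0.
- by rewrite -preimage_bigcup -[X in measurable X]setTI;
    exact: measurable_cons_pair.
Qed.

HB.instance Definition _ := isMeasure.Build _ _ _ lebesgue_cons
  lebesgue_cons0 lebesgue_cons_ge0 lebesgue_cons_sigma_additive.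

Let uncons (t : T m.+1) : measurableTypeR R * T m :=
  (thead t, [tuple of behead t]).

Let lebesgue_cons_sigma_finite : sigma_finite setT lebesgue_cons.
Proof.
have /sigma_finiteP[F [TF ndF Foo]] := sigma_finiteT (@lebesgue_measure R).
have /sigma_finiteP[G [TG ndG Goo]] := sigma_finiteT mu.
exists (fun i => uncons @^-1` (F i `*` G i)).
  rewrite -preimage_bigcup (_ : \bigcup_i _ = setT) ?preimage_setT//.
  rewrite predeqE => -[x y]; split => // _.
  have [n _ Fnx] : (\bigcup_i F i) x by rewrite -TF.
  have [k _ Gky] : (\bigcup_i G i) y by rewrite -TG.
  exists (maxn n k) => //; split => /=.
    by move: x Fnx; exact/subsetPset/ndF/leq_maxl.
  by move: y Gky; exact/subsetPset/ndG/leq_maxr.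
move=> i; have [mF Fy] := Foo i; have [mG Gy] := Goo i; split.
  rewrite -[X in measurable X]setTI.
  have mu1 : measurable_fun setT (uncons : T m.+1 -> measurableTypeR R * T m).
    apply: measurable_fun_pair; last exact: measurable_behead.
    exact: (@measurable_tnth _ (measurableTypeR R) m.+1 ord0).
  by apply: mu1 => //; exact: measurableX.
rewrite /lebesgue_cons /pushforward.
suff -> : (fun p : measurableTypeR R * T m => [tuple of p.1 :: p.2] : T m.+1)
     @^-1` (uncons @^-1` (F i `*` G i)) = F i `*` G i
  by rewrite product_measure1E// lte_mul_pinfty// ge0_fin_numE.
rewrite -comp_preimage.
have -> : uncons \o (fun p : measurableTypeR R * T m =>
    [tuple of p.1 :: p.2] : T m.+1) = id; last by [].
by apply/funext => -[a b]; congr (_, _) => /=; apply/val_inj.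
Qed.

HB.instance Definition _ := Measure_isSigmaFinite.Build _ _ _ lebesgue_cons
  lebesgue_cons_sigma_finite.
End step.

Lemma lebesgue_tuple_sigma_finite n :
  exists mu : {sigma_finite_measure set (T n) -> \bar R},
    @lebesgue_tuple R n = mu.
Proof.
elim: n => [|m [mu ih]]; first by exists (dirac [tuple]).
by exists (lebesgue_cons mu); rewrite /= ih.
Qed.

Lemma lebesgue_tuple_box n (A : 'I_n -> set (measurableTypeR R)) :
  (forall i, measurable (A i)) ->
  @lebesgue_tuple R n [set t | forall i, A i (tnth t i)] =
  (\prod_(i < n) lebesgue_measure (A i))%E.
Proof.
elim: n A => [|m ih] A mA.
  by rewrite big_ord0 /= diracE mem_set// => -[].
rewrite big_ord_recl -ih//.
have [mu muE] := lebesgue_tuple_sigma_finite m.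
rewrite /= muE /pushforward -product_measure1E//=.
  congr (_ _); apply/seteqP; split => -[a b] /=.
    move=> h; split; first by have := h ord0; rewrite tnth0.
    by move=> i; have := h (lift ord0 i); rewrite tnthS.
  by move=> [h0 h] i; case: (unliftP ord0 i) => [j|] ->;
    rewrite ?tnthS ?tnth0//.
have -> : [set t : T m | forall i, A (lift ord0 i) (tnth t i)] =
  \bigcap_(i in [set: 'I_m]) ((fun t : T m => tnth t i) @^-1` A (lift ord0 i)).
  by apply/seteqP; split => t /= h; [move=> i _; exact: h|move=> i; exact: h].
apply: fin_bigcap_measurable; first exact: finite_finset.
by move=> i _; rewrite -[X in measurable X]setTI; exact: measurable_tnth.
Qed.
End lebesgue_tuple_theory.

Definition col_of_tuple (R : realType) (n : nat)
    (t : n.-tuple (measurableTypeR R)) : 'cV[R]_n :=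
  \col_i (tnth t i : R).

Definition positive_measure (R : realType) (n : nat) (S : set 'cV[R]_n) :=
  measurable (@col_of_tuple R n @^-1` S) /\
  (0 < lebesgue_tuple (@col_of_tuple R n @^-1` S))%E.

(* Main.v *)
(* Pick a node i with positive in-degree d, and start with x_i slightly above
   Delta / 2 and all other coordinates close to 0. The quantized state is then
   Delta e_i, so x_i decreases with slope - d Delta until it reaches Delta / 2.
   It cannot stay there or go on: where x_i >= Delta / 2 its derivative is
   - d Delta, while below Delta / 2 its derivative is 0, so an absolutely
   continuous x_i can never get below Delta / 2. Hence every solution stops at
   that time, and there is none starting from x_i = Delta / 2. If all
   in-degrees vanish then L = 0 and constant functions are solutions. *)

Require Import Defs.
From HB Require Import structures.
From mathcomp Require Import all_boot all_order all_algebra.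
From mathcomp Require Import all_classical all_reals all_analysis.
From mathcomp Require Import lra.
Import Order.TTheory GRing.Theory Num.Theory.
Import numFieldNormedType.Exports.

Set Implicit Arguments.
Unset Strict Implicit.
Unset Printing Implicit Defensive.

Local Open Scope classical_set_scope.
Local Open Scope ring_scope.

(** * Mean value inequality for absolutely continuous functions *)

(** Existence of fine tagged partitions, recast as an induction principle on intervals: the radius
    [r] at the tag [t] is the gauge, and concatenation is the first hypothesis. A supremum argument
    propagates [Q a t] up to [b]. *)
Lemma cousin (R : realType) (Q : R -> R -> Prop) (a b : R) : a <= b ->
  (forall u v w, u <= v -> v <= w -> Q u v -> Q v w -> Q u w) ->
  (forall t, a <= t <= b -> exists2 r, 0 < r & forall u v,
     a <= u -> u <= t -> t <= v -> v <= b -> v - u < r -> Q u v) ->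
  Q a b.
Proof.
move=> ab Qcat Qloc; pose E := [set t | a <= t <= b /\ Q a t].
have Ea : E a.
  have [|r r0 Qr] := Qloc a; first by rewrite lexx.
  by split; [rewrite lexx|apply: Qr; rewrite ?subrr].
have ubE : ubound E b by move=> t [/andP[]].
have supE : has_sup E by split; [exists a|exists b].
have as_ : a <= sup E by apply: ub_le_sup => //; exists b.
have sb : sup E <= b by apply: ge_sup => //; exists a.
have [|r r0 Qr] := Qloc (sup E); first by rewrite as_.
have [t Et st] := sup_adherent (divr_gt0 r0 (ltr0n R 2)) supE.
have ts : t <= sup E by apply: ub_le_sup => //; exists b.
have [/andP[at_ tb] Qat] := Et.
(* A slack of [r / 2] on each side of the supremum keeps the interval from [t] to [v] shorter than
   [r]. *)
have Qext v : sup E <= v -> v <= b -> v < sup E + r / 2 -> Q a v.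
  move=> sv vb vr; apply: (Qcat _ t) => //; first exact: le_trans sv.
  by apply: Qr => //; lra.
have [bs|sb'] := leP b (sup E + r / 4); first by apply: Qext => //; lra.
have : E (sup E + r / 4) by split; [lra|apply: Qext; lra].
by move/(ub_le_sup (ex_intro _ b ubE)); lra.
Qed.

(** Lists replace indexed families so that the exceptional intervals of two adjacent partitions can
    be joined by concatenation. *)
Lemma absolutely_continuous_seq (R : realType) (V : normedModType R) (a b : R)
    (f : R -> V) (e : R) : absolutely_continuous_on a b f -> 0 < e ->
  exists2 d : R, 0 < d & forall s : seq (R * R),
    all (fun p => [&& a <= p.1, p.1 <= p.2 & p.2 <= b]) s ->
    pairwise (fun p q => p.2 <= q.1) s ->
    \sum_(p <- s) (p.2 - p.1) < d ->
    \sum_(p <- s) `|f p.2 - f p.1| < e.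
Proof.
move=> acf e0; have [d d0 fd] := acf _ e0; exists d => // s sab sdisj.
pose x0 : R * R := (0, 0).
rewrite !(big_nth x0) !big_mkord => sd.
apply: (fd _ (fun i => (nth x0 s i).1) (fun i => (nth x0 s i).2)) => //.
  by move=> i; move/all_nthP : sab => /(_ x0 i (ltn_ord i))/and3P.
move=> i j ij; move/(pairwiseP x0) : sdisj => sdisj.
have [ij'|ji|/val_inj/eqP] := ltngtP i j; last by rewrite (negbTE ij).
- by left; apply: sdisj; rewrite ?inE.
- by right; apply: sdisj; rewrite ?inE.
Qed.

(** Splitting at the tag [t] reduces the increment to one difference quotient on each side, and the
    two bounds add up. *)
Lemma is_derive_straddle (R : realType) (f : R -> R) (t l c : R) :
  is_derive t 1 f l -> l < c ->
  exists2 r, 0 < r & forall u v, u <= t -> t <= v -> v - u < r ->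
    f v - f u <= c * (v - u).
Proof.
move=> [df dl] lc; have e0 : 0 < c - l by rewrite subr_gt0.
have : h^-1 *: (f (h *: 1 + t) - f t) @[h --> 0^'] --> l by rewrite -dl; exact: df.
move/cvgrPdist_lt => /(_ _ e0)/nbhs_ballP[r /= r0 fr]; exists r => // u v ut tv vur.
have slope h : h != 0 -> `|h| < r -> `|l - h^-1 * (f (h + t) - f t)| < c - l.
  move=> h0 hr; have := fr h; rewrite /ball/= sub0r normrN => /(_ hr h0).
  by rewrite /GRing.scale/= mulr1.
have right : f v - f t <= c * (v - t).
  have [->|vt] := eqVneq v t; first by rewrite !subrr mulr0.
  have vt0 : 0 < v - t by rewrite subr_gt0 lt_neqAle eq_sym vt.
  have := slope (v - t); rewrite lt0r_neq0// gtr0_norm// subrK.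
  move=> /(_ isT) /(_ ltac:(lra)); rewrite distrC => /ltr_normlW.
  by rewrite ltrBlDr subrK mulrC ltr_pdivrMr// => /ltW.
have left : f t - f u <= c * (t - u).
  have [->|vt] := eqVneq u t; first by rewrite !subrr mulr0.
  have vt0 : u - t < 0 by rewrite subr_lt0 lt_neqAle vt.
  have := slope (u - t); rewrite ltr0_neq0// ltr0_norm// subrK.
  move=> /(_ isT) /(_ ltac:(lra)); rewrite distrC => /ltr_normlW.
  by rewrite ltrBlDr subrK mulrC ltr_ndivrMr//; lra.
lra.
Qed.

(* The null set where the derivative bound may fail is covered by an open set
   of small measure; in a tagged partition fine for a suitable gauge, absolute
   continuity controls the intervals tagged in the null set, and the derivative
   controls the others. *)
Lemma absolutely_continuous_derive_le (R : realType) (f : R -> R) (a b c : R) :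
  a <= b -> absolutely_continuous_on a b f ->
  {ae @lebesgue_measure R, forall t, a < t < b ->
     exists2 l, is_derive t 1 f l & l <= c} ->
  f b - f a <= c * (b - a).
Proof.
move=> ab acf [D [mD D0 Dsub]].
apply/ler_addgt0Pr => e e0.
(* The error [e] is split in thirds: the slope slack [e1] over the whole interval, the variation
   over the exceptional intervals, and [k] times their total length. The [+ 1] in [k] and in [e1]
   only keeps quantities positive. *)
pose k := `|c| + 1; have k0 : 0 < k by rewrite ltr_wpDl.
pose e1 := e / 3 / (b - a + 1).
have e10 : 0 < e1 by rewrite !divr_gt0// ltr_wpDl// subr_ge0.
have e1ab : e1 * (b - a) <= e / 3.
  rewrite /e1 mulrAC ler_pdivrMr; last by lra.
  by rewrite ler_pM2l; lra.
have [d0 d00 fd] := @absolutely_continuous_seq _ _ _ _ _ (e / 3) acf ltac:(lra).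
pose d := Num.min d0 (e / 3 / k).
have dpos : 0 < d by rewrite lt_min d00/= !divr_gt0.
(* The derivative is controlled only inside the open interval, so both endpoints join the
   exceptional set. *)
pose D' := D `|` [set a; b].
have mset (x : R) : measurable [set x] by exact: measurable_set1.
have mD' : measurable D' by do 2 (apply: measurableU => //).
have D'0 : lebesgue_measure D' = 0%E.
  rewrite /D' measureU0//; first exact: measurableU.
  by rewrite measureU0//; apply: lebesgue_measure_set1.
have [U [oU DU Ud]] : exists U : set R,
    [/\ open U, D' `<=` U & (lebesgue_measure U < d%:E)%E].
  have [|U [oU DU Ud]] := @lebesgue_regularity_outer R D' d mD' _ dpos.
    by rewrite [X in (X < _)%E]D'0 ltry.
  exists U; split => //.
  have mU := measurable_realfun.open_measurable oU.
  rewrite -(setDKU DU) measureU//; last 2 first.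
  - exact: measurableD.
  - by rewrite setDKI.
  by rewrite [X in (_ + X)%E]D'0 adde0.
have mU : measurable U := measurable_realfun.open_measurable oU.
(* Half-open intervals make [m] additive over adjacent intervals. *)
pose m u v := lebesgue_measure (U `&` `[u, v[).
(* The list [s] collects the intervals tagged in [D']. On these the term [(c + e1) * (v - u)] may be
   negative, and the term in [k] compensates for it because [c + k >= 0]. *)
pose Q u v := exists s : seq (R * R),
  [/\ all (fun p => [&& u <= p.1, p.1 <= p.2 & p.2 <= v]) s,
      pairwise (fun p q => p.2 <= q.1) s,
      ((\sum_(p <- s) (p.2 - p.1))%:E <= m u v)%E &
      f v - f u <= (c + e1) * (v - u)
        + \sum_(p <- s) `|f p.2 - f p.1| + k * \sum_(p <- s) (p.2 - p.1)].
have [||s [sab sdisj sm fab]] := @cousin R Q a b ab.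
- move=> u v w uv vw [s1 [s1a s1p s1m f1]] [s2 [s2a s2p s2m f2]].
  exists (s1 ++ s2); split.
  + rewrite all_cat; apply/andP; split.
      by apply: sub_all s1a => p /and3P[-> ->/= /le_trans]; exact.
    by apply: sub_all s2a => p /and3P[/(le_trans uv) -> ->/= ->].
  + rewrite pairwise_cat s1p s2p !andbT.
    apply/allrelP => p q /(allP s1a)/and3P[_ _ pv] /(allP s2a)/and3P[vq _ _].
    exact: le_trans vq.
  + rewrite big_cat/= EFinD.
    suff -> : m u w = (m u v + m v w)%E by exact: leeD.
    rewrite /m -measureU//.
    * congr lebesgue_measure; rewrite -setIUr; congr (_ `&` _).
      apply/seteqP; split => x /=; rewrite !in_itv/=.
        by move=> /andP[ux xw]; have [xv|vx] := ltP x v; [left|right]; lra.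
      by move=> [] /andP[? ?]; lra.
    * exact: measurableI.
    * exact: measurableI.
    * apply/seteqP; split => x //= [[_]]; rewrite in_itv/= => ?.
      by move=> [_]; rewrite in_itv/=; lra.
  + rewrite !big_cat/=; lra.
(* Around a tag in [D'] the gauge keeps the interval inside [U], so its length equals [m u v]. *)
- move=> t /andP[at_ tb]; have [/DU Ut|nDt] := pselect (D' t).
    have /nbhs_ballP[r /= r0 rU] : nbhs t U by exact: open_nbhs_nbhs.
    exists r => // u v au ut tv vb vur; exists [:: (u, v)] => /=; split => //.
    + by rewrite !lexx (le_trans ut tv).
    + rewrite big_seq1/= /m.
      have -> : U `&` `[u, v[ = `[u, v[%classic.
        apply/setIidPr => x /=; rewrite in_itv/= => /andP[ux xv]; apply: rU.
        by rewrite /ball/= ltr_norml; lra.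
      rewrite lebesgue_measure_itv/= lte_fin; case: ltP => [//|vu].
      by rewrite lee_fin; lra.
    + rewrite !big_seq1/=.
      have : 0 <= (c + e1 + k) * (v - u).
        by apply: mulr_ge0; [have := ler_norm (- c); rewrite normrN /k|]; lra.
      have := ler_norm (f v - f u); lra.
  have at' : a != t by apply: contra_notN nDt => /eqP <-; right; left.
  have bt' : t != b by apply: contra_notN nDt => /eqP ->; right; right.
  have tab : a < t < b by rewrite !lt_neqAle at' at_ bt' tb.
  have [l fl lc] : exists2 l, is_derive t 1 f l & l <= c.
    apply: contra_notP nDt => ntc; left; apply: Dsub => /= /(_ tab); exact: ntc.
  have [|r r0 fr] := @is_derive_straddle _ _ _ _ (c + e1) fl; first by lra.
  exists r => // u v au ut tv vb vur; exists [::]; split => //.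
  - by rewrite big_nil measure_ge0.
  - by rewrite !big_nil mulr0 !addr0; exact: fr.
have sd : \sum_(p <- s) (p.2 - p.1) < d.
  rewrite -lte_fin (le_lt_trans sm)// (le_lt_trans _ Ud)//.
  by apply: le_measure; rewrite ?inE//; apply: measurableI.
have := sd; rewrite lt_min => /andP[sd0]; rewrite ltr_pdivlMr// mulrC.
have := fd s sab sdisj sd0; lra.
Qed.

(** * Derivative comparisons and the barrier principle *)

Lemma ae_imply (R : realType) (P Q : R -> Prop) :
  {ae @lebesgue_measure R, forall t, P t} -> (forall t, P t -> Q t) ->
  {ae @lebesgue_measure R, forall t, Q t}.
Proof. by move=> Pae PQ; apply: negligibleS Pae => t; apply: contra_not; exact: PQ. Qed.

Lemma absolutely_continuousN (R : realType) (V : normedModType R) (a b : R)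
    (f : R -> V) :
  absolutely_continuous_on a b f -> absolutely_continuous_on a b (fun t => - f t).
Proof.
move=> acf e /acf[d d0 fd]; exists d => // n u v uv disj uvd.
under eq_bigr do rewrite -opprD normrN; exact: fd.
Qed.

Lemma absolutely_continuousS (R : realType) (V : normedModType R)
    (a b a' b' : R) (f : R -> V) : a <= a' -> b' <= b ->
  absolutely_continuous_on a b f -> absolutely_continuous_on a' b' f.
Proof.
move=> aa' b'b acf e /acf[d d0 fd]; exists d => // n u v uv; apply: fd => i.
by have [au uv' vb] := uv i; split => //; lra.
Qed.

Lemma absolutely_continuous_uniform (R : realType) (V : normedModType R)
    (a b e : R) (f : R -> V) : absolutely_continuous_on a b f -> 0 < e ->
  exists2 d, 0 < d & forall u v, a <= u -> u <= v -> v <= b -> v - u < d ->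
    `|f v - f u| < e.
Proof.
move=> acf /acf[d d0 fd]; exists d => // u v au uv vb uvd.
have := fd 1%N (fun=> u) (fun=> v); rewrite !big_ord1; apply => //.
by move=> i j; rewrite !ord1 eqxx.
Qed.

Lemma absolutely_continuous_derive_ge (R : realType) (f : R -> R) (a b c : R) :
  a <= b -> absolutely_continuous_on a b f ->
  {ae @lebesgue_measure R, forall t, a < t < b ->
     exists2 l, is_derive t 1 f l & c <= l} ->
  c * (b - a) <= f b - f a.
Proof.
move=> ab acf fae.
suff : - f b - - f a <= - c * (b - a) by lra.
apply: (@absolutely_continuous_derive_le R (fun t => - f t)) => //.
  exact: absolutely_continuousN.
apply: (ae_imply fae) => t /[apply] -[l fl cl]; exists (- l); last by lra.
exact: is_deriveN.
Qed.

Lemma absolutely_continuous_derive_eq (R : realType) (f : R -> R) (a b c : R) :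
  a <= b -> absolutely_continuous_on a b f ->
  {ae @lebesgue_measure R, forall t, a < t < b -> is_derive t 1 f c} ->
  f b - f a = c * (b - a).
Proof.
move=> ab acf fae; apply/eqP; rewrite eq_le; apply/andP; split.
  apply: absolutely_continuous_derive_le => //.
  by apply: (ae_imply fae) => t /[apply]; exists c.
apply: absolutely_continuous_derive_ge => //.
by apply: (ae_imply fae) => t /[apply]; exists c.
Qed.

(** After the last time at which [h <= f], the derivative is almost everywhere nonnegative, so [f]
    cannot end below its value at that time. *)
Lemma absolutely_continuous_barrier (R : realType) (f : R -> R) (a b h : R) :
  a <= b -> absolutely_continuous_on a b f -> h <= f a ->
  {ae @lebesgue_measure R, forall t, a < t < b -> f t < h ->
     exists2 l, is_derive t 1 f l & 0 <= l} ->
  h <= f b.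
Proof.
move=> ab acf ha fae; rewrite leNgt; apply/negP => fbh.
pose E := [set t | a <= t <= b /\ h <= f t].
have ubE : ubound E b by move=> t [/andP[]].
have Ea : E a by split; rewrite ?lexx.
have supE : has_sup E by split; [exists a|exists b].
have as_ : a <= sup E by apply: ub_le_sup => //; exists b.
have sb : sup E <= b by apply: ge_sup => //; exists a.
(* By continuity the supremum is itself a time at which [h <= f]. *)
have fs : h <= f (sup E).
  apply/ler_addgt0Pr => e e0.
  have [d d0 fd] := absolutely_continuous_uniform acf e0.
  have [t [/andP[at_ tb] hft] st] := sup_adherent d0 supE.
  have ts : t <= sup E by apply: ub_le_sup => //; [exists b|split; rewrite ?at_].
  have := fd t (sup E) at_ ts sb ltac:(lra); rewrite ltr_norml; lra.
have := @absolutely_continuous_derive_ge R f (sup E) b 0 sb.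
have /[swap] /[apply] := absolutely_continuousS as_ (lexx b) acf.
have /[swap] /[apply] : {ae @lebesgue_measure R, forall t, sup E < t < b ->
     exists2 l, is_derive t 1 f l & 0 <= l}.
  apply: (ae_imply fae) => t ft /andP[st tb]; apply: ft; first by lra.
  rewrite ltNge; apply/negP => hft.
  have : E t by split => //; lra.
  by move/(ub_le_sup (ex_intro _ b ubE)); lra.
lra.
Qed.

(** * Passage from vectors to coordinates *)

Lemma ler_coord_norm (R : realType) (m n : nat) (z : 'M[R]_(m, n)) i j :
  `|z i j| <= `|z|.
Proof.
rewrite [leRHS]mx_normrE.
exact: (le_bigmax_cond _ (fun ij : 'I_m * 'I_n => `|z ij.1 ij.2|) (j := (i, j))).
Qed.

Lemma absolutely_continuous_coord (R : realType) (m n : nat) (a b : R)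
    (x : R -> 'M[R]_(m, n)) i j :
  absolutely_continuous_on a b x ->
  absolutely_continuous_on a b (fun t => x t i j).
Proof.
move=> acx e /acx[d d0 xd]; exists d => // k u v uv disj uvd.
apply: le_lt_trans (xd k u v uv disj uvd); apply: ler_sum => l _.
by have := @ler_coord_norm R _ _ (x (v l) - x (u l)) i j; rewrite !mxE.
Qed.

Lemma is_derive_coord (R : realType) (m n : nat) (x : R -> 'M[R]_(m, n))
    (t : R) (v : 'M[R]_(m, n)) i j :
  is_derive t 1 x v -> is_derive t 1 (fun s => x s i j) (v i j).
Proof.
move=> [dx <-]; rewrite derive_mx// mxE; apply: derivableP.
by move/derivable_mxP : dx; exact.
Qed.

(** * Dynamics near the quantization threshold of node [i] *)

Section cell.
Context {R : realType} {N : nat} (G : wdigraph R N) (i : 'I_N) (Delta : R).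
Hypothesis Delta_gt0 : 0 < Delta.

Let h := Delta / 2.

Lemma laplacian_delta : laplacian G *m delta_mx i 0 =
  \col_j (if j == i then \sum_k adj G i k else - adj G j i).
Proof.
rewrite -colE; apply/colP => j; rewrite !mxE.
have [->|ji] := eqVneq j i.
  (* Without self-loops the diagonal entry is the full in-degree. *)
  rewrite mulr1n (adj_eq0 (edges_irrefl G i)) subr0.
  by apply: eq_bigr => k _; rewrite mxE mulr1.
by rewrite mulr0n sub0r.
Qed.

(** The region where the quantized state is either zero or [Delta] times the [i]-th basis vector. *)
Definition two_cells (z : 'cV[R]_N) :=
  - h <= z i 0 < 3 * h /\ forall j, j != i -> - h <= z j 0 < h.

Lemma quantizer0 r : - h <= r < h -> quantizer Delta r = 0.
Proof.
rewrite /h => rh; rewrite /quantizer (@floor_def _ _ 0) ?mul0r//.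
have E : r = r / Delta * Delta by rewrite divfK ?gt_eqF.
have : - (1/2) * Delta <= r / Delta * Delta < 1/2 * Delta by lra.
by rewrite ler_pM2r// ltr_pM2r// => ?; lra.
Qed.

Lemma quantizer1 r : h <= r < 3 * h -> quantizer Delta r = Delta.
Proof.
rewrite /h => rh; rewrite /quantizer (@floor_def _ _ 1) ?mul1r//.
have E : r = r / Delta * Delta by rewrite divfK ?gt_eqF.
have : (1/2) * Delta <= r / Delta * Delta < 3/2 * Delta by lra.
by rewrite ler_pM2r// ltr_pM2r// => ?; lra.
Qed.

Lemma quantizer_two_cells z : two_cells z ->
  map_mx (quantizer Delta) z = (if h <= z i 0 then Delta else 0) *: delta_mx i 0.
Proof.
move=> [zi zj]; apply/colP => j; rewrite !mxE eqxx andbT.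
have [->|ji] := eqVneq j i; last by rewrite mulr0 quantizer0// zj.
by rewrite mulr1; case: ifPn => hz; [rewrite quantizer1|rewrite quantizer0]; lra.
Qed.

Lemma is_derive_two_cells (x : R -> 'cV[R]_N) t : two_cells (x t) ->
  is_derive t 1 x (- (laplacian G *m map_mx (quantizer Delta) (x t))) ->
  forall j, is_derive t 1 (fun s => x s j 0)
    ((if h <= x t i 0 then Delta else 0) *
     (if j == i then - \sum_k adj G i k else adj G j i)).
Proof.
move=> xt dx j; apply: is_derive_eq; first exact: is_derive_coord dx.
rewrite quantizer_two_cells// -scalemxAr laplacian_delta !mxE.
by rewrite -mulrN; case: (j == i); rewrite ?opprK.
Qed.

(** Below [h] the field vanishes, so the barrier principle keeps coordinate [i] at or above [h]. The
    field is then constant along the solution, and every coordinate moves linearly. *)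
Lemma two_cells_flow (x : R -> 'cV[R]_N) (T : R) : 0 <= T ->
  absolutely_continuous_on 0 T x ->
  {ae @lebesgue_measure R, forall t, 0 < t < T ->
    is_derive t 1 x (- (laplacian G *m map_mx (quantizer Delta) (x t)))} ->
  (forall t, 0 <= t <= T -> two_cells (x t)) -> h <= x 0 i 0 ->
  h <= x T i 0 /\
  forall j, x T j 0 = x 0 j 0 + T * Delta *
     (if j == i then - \sum_k adj G i k else adj G j i).
Proof.
move=> T0 acx xae xcell hx0.
have hx t : 0 <= t <= T -> h <= x t i 0.
  move=> /andP[t0 tT].
  apply: (@absolutely_continuous_barrier R (fun s => x s i 0) 0 t) => //.
    by apply: absolutely_continuous_coord; exact: absolutely_continuousS acx.
  apply: (ae_imply xae) => s xs /andP[s0 st] xsh; exists 0 => //.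
  have sT : 0 < s < T by lra.
  have := @is_derive_two_cells x s (xcell s ltac:(lra)) (xs sT) i.
  by rewrite leNgt xsh/= mul0r.
split; first by apply: hx; lra.
move=> j; set c := (if _ then _ else _).
suff : x T j 0 - x 0 j 0 = Delta * c * (T - 0) by lra.
apply: (@absolutely_continuous_derive_eq R (fun s => x s j 0)) => //.
  exact: absolutely_continuous_coord.
apply: (ae_imply xae) => s xs sT.
have := @is_derive_two_cells x s (xcell s ltac:(lra)) (xs sT) j.
by rewrite hx//; lra.
Qed.

Hypothesis balanced : weight_balanced G.
Hypothesis indegree_gt0 : 0 < \sum_k adj G i k.

Lemma adj_ge0 j k : 0 <= adj G j k.
Proof.
have [e|e] := boolP ((k, j) \in edges G); first by rewrite ltW// adj_gt0.
by rewrite adj_eq0.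
Qed.

(* While x_i falls to [Delta / 2], by at most [Delta / 8], the other coordinates
   rise by no more than that, since weight balance gives
   [adj G j i <= \sum_k adj G i k]; so they stay within their quantization cell. *)
Definition initial_cell (z : 'cV[R]_N) :=
  h <= z i 0 < h + Delta / 8 /\
  forall j, j != i -> - (Delta / 8) <= z j 0 < Delta / 8.

(** Coordinate [i] falls linearly yet never goes below [h], which bounds [T]. The linear formula
    needs the solution to stay in [two_cells]; this is bootstrapped by short time steps. *)
Lemma initial_cell_blowup (x : R -> 'cV[R]_N) (T : R) : 0 <= T ->
  initial_cell (x 0) -> absolutely_continuous_on 0 T x ->
  {ae @lebesgue_measure R, forall t, 0 < t < T ->
    is_derive t 1 x (- (laplacian G *m map_mx (quantizer Delta) (x t)))} ->
  T * Delta * \sum_k adj G i k <= x 0 i 0 - h.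
Proof.
move=> T0 [x0i x0j] acx xae.
have flow t : 0 <= t <= T -> (forall s, 0 <= s <= t -> two_cells (x s)) ->
  h <= x t i 0 /\ forall j, x t j 0 = x 0 j 0 + t * Delta *
     (if j == i then - \sum_k adj G i k else adj G j i).
  move=> /andP[t0 tT] xcell; apply: two_cells_flow => //; last by lra.
    exact: absolutely_continuousS acx.
  by apply: (ae_imply xae) => s + s0; apply; lra.
have e0 : 0 < Delta / 8 by lra.
have [d d0 xd] := absolutely_continuous_uniform acx e0.
(* Induction on the number of steps of length [d / 2]: within one step each coordinate moves by less
   than [Delta / 8], too little to leave the region from a point given by the linear formula. *)
have cells (n : nat) t : 0 <= t <= T -> t <= n%:R * (d / 2) -> two_cells (x t).
  elim: n t => [|n IHn] t tT tn.
    have -> : t = 0 by lra.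
    by split; [rewrite /h in x0i *; lra|move=> j /x0j; rewrite /h; lra].
  have [tn'|nt] := leP t (n%:R * (d / 2)); first exact: IHn.
  set s := n%:R * (d / 2) in nt.
  have s0 : 0 <= s by rewrite mulr_ge0//; lra.
  have sT : 0 <= s <= T by lra.
  have [|hs xs] := flow s sT; first by move=> r rs; apply: IHn; rewrite -/s; lra.
  have ts : t - s < d by move: tn; rewrite -natr1 mulrDl -/s; lra.
  have near j : - (Delta / 8) < x t j 0 - x s j 0 < Delta / 8.
    rewrite -ltr_norml; apply: le_lt_trans (xd s t s0 (ltW nt) _ ts); last by lra.
    by have := @ler_coord_norm R _ _ (x t - x s) j 0; rewrite !mxE.
  have xsi := xs i; rewrite eqxx in xsi.
  have sD0 : 0 <= s * Delta by rewrite mulr_ge0// ltW.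
  have sDd : 0 <= s * Delta * \sum_k adj G i k by rewrite mulr_ge0// ltW.
  split; first by have := near i; rewrite /h in x0i hs *; lra.
  (* The initial value, the linear rise and the last step each contribute less than [Delta / 8], so
     the sum stays below [h]. *)
  move=> j ji; have := xs j; rewrite (negbTE ji) => xsj.
  have adjji : adj G j i <= \sum_k adj G i k.
    rewrite balanced (bigD1 j)//= lerDl sumr_ge0// => k _; exact: adj_ge0.
  have := ler_wpM2l sD0 adjji.
  have := mulr_ge0 sD0 (adj_ge0 j i).
  by have := near j; have := x0j j ji; rewrite /h in x0i hs *; lra.
have [||hT xT] := flow T; first by rewrite lexx T0.
  move=> s sT; apply: (cells (Num.truncn (T / (d / 2))).+1) => //.
  have d20 : 0 < d / 2 by lra.
  apply: (@le_trans _ _ T); first by lra.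
  by rewrite -ler_pdivrMr// ltW// truncnS_gt.
by have := xT i; rewrite eqxx; lra.
Qed.

End cell.

(** * Bounded lifetime and nonexistence of solutions *)

(** An interval [I] containing [0] and [T] contains everything between them, so the time bound
    applies to it. *)
Lemma no_solution_past_blowup (R : realType) (N : nat) (G : wdigraph R N)
    (i : 'I_N) (Delta T : R) (x0 : 'cV[R]_N) (I : set R) (x : R -> 'cV[R]_N) :
  0 < Delta -> weight_balanced G -> 0 < \sum_k adj G i k ->
  initial_cell i Delta x0 -> caratheodory_solution_from Delta G x0 I x ->
  0 <= T -> I T -> T * Delta * \sum_k adj G i k <= x0 i 0 - Delta / 2.
Proof.
move=> D0 bG di x0i [_ I0 _ [Iitv acx xae] xx0] T0 IT.
have I0T t : 0 <= t <= T -> I t by move=> tT; exact: (Iitv 0 T I0 IT).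
rewrite -xx0; apply: (initial_cell_blowup D0 bG di T0); first by rewrite xx0.
  by apply: acx => // t /=; rewrite in_itv/=; exact: I0T.
by apply: (ae_imply xae) => t + t0T; apply; apply: I0T; lra.
Qed.

(** At this initial condition the bound on lifetimes is zero, whereas [I] contains a positive
    time. *)
Lemma no_solution_at_threshold (R : realType) (N : nat) (G : wdigraph R N)
    (i : 'I_N) (Delta : R) : 0 < Delta -> weight_balanced G ->
  0 < \sum_k adj G i k ->
  no_caratheodory_solution Delta G (Delta / 2 *: delta_mx i 0).
Proof.
move=> D0 bG di [I [x sol]]; have [_ _ [T T0 IT] _ _] := sol.
have := no_solution_past_blowup D0 bG di _ sol (ltW T0) IT.
rewrite !mxE !eqxx mulr1 subrr leNgt !mulr_gt0// => /(_ _)/negP; apply => //.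
split; first by rewrite !mxE !eqxx mulr1; lra.
by move=> j ji; rewrite !mxE (negbTE ji) mulr0; lra.
Qed.

Lemma constant_solution (R : realType) (N : nat) (G : wdigraph R N)
    (Delta : R) (x0 : 'cV[R]_N) : laplacian G = 0 ->
  caratheodory_solution_from Delta G x0 `[0, +oo[%classic (cst x0).
Proof.
move=> L0; split => //=.
- by rewrite in_itv/= lexx.
- by exists 1 => //; rewrite in_itv/= ler01.
split.
- exact: interval_is_interval.
- move=> a b _ _ e e0; exists 1 => // n u v _ _ _.
  by under eq_bigr do rewrite subrr normr0; rewrite big1.
- apply: (@ae_imply R (fun=> True)) => [|t _ _].
    exact: aeW.
  by rewrite L0 mul0mx oppr0; exact: is_derive_cst.
Qed.

(** Weights are nonnegative, so a nonpositive row sum makes every weight in the row vanish. *)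
Lemma laplacian_eq0 (R : realType) (N : nat) (G : wdigraph R N) :
  (forall i, \sum_k adj G i k <= 0) -> laplacian G = 0.
Proof.
move=> d0; have adj0 i j : adj G i j = 0.
  apply: le_anti; rewrite adj_ge0 andbT; apply: le_trans (d0 i).
  by rewrite (bigD1 j)//= lerDl sumr_ge0// => k _; exact: adj_ge0.
apply/matrixP => i j; rewrite !mxE adj0 subr0 big1 ?mul0rn//.
by move=> k _; rewrite adj0 mul0r.
Qed.

(** * Positive measure of the set of initial conditions *)

Lemma prode_gt0 (R : realType) (n : nat) (F : 'I_n -> \bar R) :
  (forall i, 0 < F i)%E -> (0 < \prod_(i < n) F i)%E.
Proof. by move=> F0; elim/big_ind : _ => // a b; exact: mule_gt0. Qed.

Lemma positive_measure_box (R : realType) (n : nat) (l u : 'I_n -> R) :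
  (forall i, l i < u i) ->
  positive_measure [set z : 'cV[R]_n | forall i, l i <= z i 0 < u i].
Proof.
move=> lu; pose A i : set (measurableTypeR R) := `[l i, u i[%classic.
have mA i : measurable (A i) by exact: measurable_itv.
have E : @col_of_tuple R n @^-1` [set z | forall i, l i <= z i 0 < u i] =
    [set t | forall i, A i (tnth t i)].
  by apply/seteqP; split => t /= tA i; have := tA i; rewrite /A/= in_itv/= mxE.
rewrite /positive_measure E; split; last first.
  rewrite lebesgue_tuple_box//; apply: prode_gt0 => i.
  by rewrite /A lebesgue_measure_itv/= lte_fin lu lte_fin subr_gt0.
have -> : [set t : n.-tuple (measurableTypeR R) | forall i, A i (tnth t i)] =
    \bigcap_(i in [set: 'I_n])
      ((fun t : n.-tuple (measurableTypeR R) => tnth t i) @^-1` A i).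
  by apply/seteqP; split => t /= tA i; [move=> _|]; exact: tA.
apply: fin_bigcap_measurable; first exact: finite_finset.
by move=> i _; rewrite -[X in measurable X]setTI; exact: measurable_tnth.
Qed.

Lemma positive_measure_initial_cell (R : realType) (N : nat) (i : 'I_N)
    (Delta : R) : 0 < Delta -> positive_measure (initial_cell i Delta).
Proof.
move=> D0.
have := @positive_measure_box R N
  (fun j => if j == i then Delta / 2 else - (Delta / 8))
  (fun j => if j == i then Delta / 2 + Delta / 8 else Delta / 8) _.
rewrite (_ : [set z | _] = initial_cell i Delta).
  by apply => j; case: ifP => _; lra.
apply/seteqP; split => z /=.
  move=> zb; split; first by have := zb i; rewrite eqxx.
  by move=> j ji; have := zb j; rewrite (negbTE ji).
by move=> [zi zj] j; case: eqVneq => [->//|]; exact: zj.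
Qed.

(** * A two-node example with unit weights in both directions *)

Section two_nodes.
Variable R : realType.

Let adj2 : 'M[R]_2 := \matrix_(i, j) (i != j)%:R.
Let edges2 : {set 'I_2 * 'I_2} := [set e | e.1 != e.2].

Let edges2_irrefl i : (i, i) \notin edges2.
Proof. by rewrite inE/= eqxx. Qed.

Let adj2_gt0 i j : (j, i) \in edges2 -> 0 < adj2 i j.
Proof. by rewrite inE/= mxE eq_sym => ->. Qed.

Let adj2_eq0 i j : (j, i) \notin edges2 -> adj2 i j = 0.
Proof. by rewrite inE/= mxE negbK => /eqP->; rewrite eqxx. Qed.

Definition two_cycle : wdigraph R 2 :=
  WDigraph edges2_irrefl adj2_gt0 adj2_eq0.

Lemma two_cycle_connected : weakly_connected two_cycle.
Proof.
move=> i j; have [->|ij] := eqVneq i j; first exact: connect0.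
by apply: connect1; rewrite !inE/= ij.
Qed.

Lemma two_cycle_balanced : weight_balanced two_cycle.
Proof. by move=> i; apply: eq_bigr => j _; rewrite !mxE eq_sym. Qed.

Lemma two_cycle_indegree : 0 < \sum_k adj two_cycle ord0 k.
Proof. by rewrite big_ord_recl big_ord1 !mxE/= add0r ltr01. Qed.

End two_nodes.

Unset Implicit Arguments.

Theorem proposition1 (R : realType) (Delta : R) (Delta_gt0 : 0 < Delta) :
  (exists (N : nat) (G : wdigraph R N),
     [/\ weakly_connected G, weight_balanced G
       & exists x0 : 'cV[R]_N, no_caratheodory_solution Delta G x0]) /\
  (forall (N : nat) (G : wdigraph R N),
     weakly_connected G -> weight_balanced G ->
     (exists x0 : 'cV[R]_N, no_caratheodory_solution Delta G x0) ->
     exists S : set 'cV[R]_N, positive_measure S /\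
       forall (x0 : 'cV[R]_N) (I : set R) (x : R -> 'cV[R]_N),
         S x0 -> caratheodory_solution_from Delta G x0 I x ->
         ~ complete_domain I).
Proof.
split.
  exists 2%N, (two_cycle R); split.
  - exact: two_cycle_connected.
  - exact: two_cycle_balanced.
  - exists (Delta / 2 *: delta_mx ord0 0); apply: no_solution_at_threshold => //.
      exact: two_cycle_balanced.
    exact: two_cycle_indegree.
move=> N G _ bG [z noz].
(* The point [z] without solutions forces some in-degree to be positive, for otherwise the constant
   function [cst z] is a solution. *)
have [[i di]|nod] := pselect (exists i, 0 < \sum_k adj G i k); last first.
  exfalso; apply: noz; exists `[0, +oo[%classic, (cst z).
  apply: constant_solution; apply: laplacian_eq0 => i.
  by rewrite leNgt; apply/negP => di; apply: nod; exists i.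
exists (initial_cell i Delta); split; first exact: positive_measure_initial_cell.
move=> x0 I x x0i sol Icomplete.
have Dd : 0 < Delta * \sum_k adj G i k by rewrite mulr_gt0.
have y0 : 0 <= x0 i 0 - Delta / 2 by have [] := x0i; lra.
(* One unit of time after coordinate [i] would reach the threshold; a complete domain would contain
   this [T]. *)
pose T := (x0 i 0 - Delta / 2) / (Delta * \sum_k adj G i k) + 1.
have T0 : 0 <= T by rewrite addr_ge0// divr_ge0// ltW.
have IT : I T by rewrite Icomplete/= in_itv/= T0.
have := no_solution_past_blowup Delta_gt0 bG di x0i sol T0 IT.
by rewrite -mulrA mulrDl divfK ?gt_eqF// mul1r gerDl leNgt Dd.
Qed.
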